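(* Let $M$ be a nontrivial concircular surface in $\mathbb{M}^3(C)$, locally parametrized by $$X(t,z)=f\Big(\frac zR\Big)\delta(t)+R\,g\Big(\frac zR\Big)\big(\cos(a)N_\delta(t)+\sin(a)\eta(t)\big).$$ An arclength parametrized curve $\gamma(s)=X(t(s),z(s))$, with $\kappa_\gamma>0$, is a geodesic of $M$ if and only if there is a differentiable function $\theta(s)$ such that $$t'(s)\sqrt{E(t(s),z(s))}=\sin\theta(s),\qquad z'(s)=\cos\theta(s),$$ $$\theta'(s)=t'(s)\Big(CR\,g\big(\tfrac{z(s)}{R}\big)+f\big(\tfrac{z(s)}{R}\big)\big(\sin(a)\,k+\cos(a)\,\kappa_\delta(t(s))\big)\Big).$$ Moreover, in that case (with the unit normal satisfying $N_\gamma=N$ along $\gamma$) the curvature and torsion of $\gamma$ are given by $$\kappa_\gamma(s)=\sin\theta(s)\,t'(s)\big(k\cos(a)-\sin(a)\kappa_\delta(t(s))\big),$$ $$\tau_\gamma(s)=\cos\theta(s)\,t'(s)\big(-\cos(a)k+\sin(a)\kappa_\delta(t(s))\big).$$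
   Context: Let $C\neq0$ be real, $C=\varepsilon/R^2$, $R>0$, $\varepsilon=(-1)^\nu$, $\nu\in\{0,1\}$. $\mathbb{R}^{4}_\nu$ is $\mathbb{R}^{4}$ with the flat metric $\langle\,,\rangle=\varepsilon\,dx_1^2+dx_2^2+dx_3^2+dx_4^2$, and $\mathbb{M}^3(C)=\{p\in\mathbb{R}^4_\nu:\langle p,p\rangle=1/C\}$ (the sheet $x_1>0$ if $C<0$) with the induced metric, of constant curvature $C$ and Levi-Civita connection $\overline\nabla$. Put $f=\cos$, $g=\sin$ if $C>0$; $f=\cosh$, $g=\sinh$ if $C<0$. A vector field $V$ on $\mathbb{M}^3(C)$ is concircular if $\overline\nabla_XV=\mu X$ for all tangent $X$, for some smooth function $\mu$; a surface $M\subset\mathbb{M}^3(C)$ with unit normal $N$ is concircular with axis $V$ if $V$ is concircular and $\langle N,V\rangle$ is constant on $M$; it is nontrivial if it is not totally umbilical. In the parametrization: $Q^2(c)$ is a totally umbilical surface of $\mathbb{M}^3(C)$ (intersection of $\mathbb{M}^3(C)$ with an affine hyperplane of $\mathbb{R}^4_\nu$) with unit normal $\eta$ in $\mathbb{M}^3(C)$ and constant $k$ given by $\overline\nabla_Y\eta=-kY$ for $Y$ tangent to $Q^2(c)$; $\delta(t)$ is an arclength parametrized curve in $Q^2(c)$ with unit tangent $T_\delta$, unit normal $N_\delta$ in $Q^2(c)$ and geodesic curvature $\kappa_\delta$ in $Q^2(c)$, so that $T_\delta'=k\eta-C\delta+\kappa_\delta N_\delta$ (derivative in $\mathbb{R}^4_\nu$),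 and $\eta(t)=\eta(\delta(t))$; $a\in\mathbb{R}$ is a constant; $z$ ranges in a sufficiently small interval around $0$, so that $X$ is an immersion with $X_t=\sqrt{E}\,T_\delta$, where $E=\langle X_t,X_t\rangle>0$. The unit normal of $M$ is $N(t,z)=-\sin(a)N_\delta(t)+\cos(a)\eta(t)$. The curvature $\kappa_\gamma$, torsion $\tau_\gamma$ and Frenet frame of $\gamma$ in $\mathbb{M}^3(C)$ are defined by $\overline\nabla_{T_\gamma}T_\gamma=\kappa_\gamma N_\gamma$, $\overline\nabla_{T_\gamma}N_\gamma=-\kappa_\gamma T_\gamma+\tau_\gamma B_\gamma$, $\overline\nabla_{T_\gamma}B_\gamma=-\tau_\gamma N_\gamma$, where $(T_\gamma,N_\gamma,B_\gamma)$ is positively oriented for the orientation of $\mathbb{M}^3(C)$ in which $(T_\delta,X_z,N)$ is positive. *)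

(* Defs.v *)
From HB Require Import structures.
From mathcomp Require Import all_boot all_order all_algebra.
From mathcomp Require Import all_classical all_reals all_analysis.

Set Implicit Arguments.
Unset Strict Implicit.
Unset Printing Implicit Defensive.

Import Order.TTheory GRing.Theory Num.Theory.
Import numFieldNormedType.Exports.

Local Open Scope ring_scope.
Local Open Scope classical_set_scope.

Definition cosh (R : realType) (x : R) : R := (expR x + expR (- x)) / 2.
Definition sinh (R : realType) (x : R) : R := (expR x - expR (- x)) / 2.

Definition fC (R : realType) (C x : R) : R := if 0 < C then cos x else cosh x.
Definition gC (R : realType) (C x : R) : R := if 0 < C then sin x else sinh x.

(* C^oo on A (meant for open A): every iterated directional derivative of F
   is differentiable at every point of A.  For V := R the directions are
   scalars, so this is ordinary smoothness of a curve. *)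
Definition smooth_on (R : realType) (V W : normedModType R)
    (A : set V) (F : V -> W) : Prop :=
  forall (vs : seq V) (p : V), A p ->
    differentiable (foldr (fun v (G : V -> W) => 'D_v G) F vs) p.

(* A smooth map on the submanifold A, given as a total function that is smooth
   on some open neighbourhood of A (values elsewhere are irrelevant). *)
Definition smooth_near (R : realType) (V W : normedModType R)
    (A : set V) (F : V -> W) : Prop :=
  exists U : set V, [/\ open U, A `<=` U & smooth_on U F].

Definition open_interval (R : realType) (I : set R) : Prop :=
  open I /\ is_interval I.

(* The metric of R^4_nu; x_1 is the coordinate of index 0. *)
Definition ip (R : realType) (nu : bool) (u v : 'rV[R]_4) : R :=
  (-1) ^+ nu * u 0 0 * v 0 0 + \sum_(i < 4 | i != 0) u 0 i * v 0 i.

Definition M3 (R : realType) (nu : bool) (C : R) : set 'rV[R]_4 :=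
  [set p | ip nu p p = C^-1 /\ (C < 0 -> 0 < p 0 0)].

Definition tangent_M3 (R : realType) (nu : bool) (p v : 'rV[R]_4) : Prop :=
  ip nu v p = 0.

(* Orthogonal projection of R^4_nu onto T_p M^3(C), using <p,p> = 1/C. *)
Definition proj_M3 (R : realType) (nu : bool) (C : R) (p v : 'rV[R]_4) :
    'rV[R]_4 :=
  v - (C * ip nu v p) *: p.

(* The Levi-Civita connection of M^3(C) is the tangential part of the flat one:
   [nabla] differentiates a field V in the tangent direction Y at p, [covD]
   differentiates a field W along the curve alpha. *)
Definition nabla (R : realType) (nu : bool) (C : R)
    (V : 'rV[R]_4 -> 'rV[R]_4) (p Y : 'rV[R]_4) : 'rV[R]_4 :=
  proj_M3 nu C p ('D_Y V p).

Definition covD (R : realType) (nu : bool) (C : R)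
    (alpha W : R -> 'rV[R]_4) (s : R) : 'rV[R]_4 :=
  proj_M3 nu C (alpha s) (derive1 W s).

(* Covariant derivative, along a curve alpha, of the Levi-Civita connection of
   a surface of M^3(C) whose unit normal along alpha is n. *)
Definition surf_covD (R : realType) (nu : bool) (C : R)
    (alpha n W : R -> 'rV[R]_4) (s : R) : 'rV[R]_4 :=
  covD nu C alpha W s - ip nu (covD nu C alpha W s) (n s) *: n s.

Definition concircular_field (R : realType) (nu : bool) (C : R)
    (V : 'rV[R]_4 -> 'rV[R]_4) : Prop :=
  [/\ smooth_near (M3 nu C) V,
      forall p, M3 nu C p -> tangent_M3 nu p (V p) &
      exists2 mu : 'rV[R]_4 -> R, smooth_near (M3 nu C) mu &
        forall p Y, M3 nu C p -> tangent_M3 nu p Y ->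
          nabla nu C V p Y = mu p *: Y].

Definition d_t (R : realType) (X : R -> R -> 'rV[R]_4) (t z : R) : 'rV[R]_4 :=
  derive1 (X^~ z) t.
Definition d_z (R : realType) (X : R -> R -> 'rV[R]_4) (t z : R) : 'rV[R]_4 :=
  derive1 (X t) z.

(* X : I x J -> M^3(C) is an immersed surface with unit normal N. *)
Definition immersed_surface (R : realType) (nu : bool) (C : R) (I J : set R)
    (X N : R -> R -> 'rV[R]_4) : Prop :=
  [/\ smooth_on (I `*` J) (fun p : R * R => X p.1 p.2),
      smooth_on (I `*` J) (fun p : R * R => N p.1 p.2),
      forall t z, I t -> J z ->
        M3 nu C (X t z) /\ row_free (col_mx (d_t X t z) (d_z X t z)) &
      forall t z, I t -> J z ->
        [/\ tangent_M3 nu (X t z) (N t z), ip nu (N t z) (d_t X t z) = 0,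
            ip nu (N t z) (d_z X t z) = 0 & ip nu (N t z) (N t z) = 1]].

Definition concircular_surface (R : realType) (nu : bool) (C : R)
    (I J : set R) (X N : R -> R -> 'rV[R]_4) : Prop :=
  immersed_surface nu C I J X N /\
  exists2 V, concircular_field nu C V &
    exists c : R, forall t z, I t -> J z -> ip nu (N t z) (V (X t z)) = c.

(* The shape operator is a multiple of the identity at every point. *)
Definition totally_umbilical (R : realType) (nu : bool) (C : R)
    (I J : set R) (X N : R -> R -> 'rV[R]_4) : Prop :=
  forall t z, I t -> J z -> exists lambda : R,
    covD nu C (X^~ z) (N^~ z) t = - lambda *: d_t X t z /\
    covD nu C (X t) (N t) z = - lambda *: d_z X t z.

(* Every affine hyperplane of R^4_nu is {<p,w> = d} with w != 0. *)
Definition Q2 (R : realType) (nu : bool) (C : R) (w : 'rV[R]_4) (d : R) :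
    set 'rV[R]_4 :=
  M3 nu C `&` [set p | ip nu p w = d].

Definition tangent_Q2 (R : realType) (nu : bool) (w p Y : 'rV[R]_4) : Prop :=
  tangent_M3 nu p Y /\ ip nu Y w = 0.

(* The existence of eta excludes the degenerate sections (a single point),
   where tangent_Q2 would be all of T_p M^3(C). *)
Definition Q2_normal (R : realType) (nu : bool) (C : R) (w : 'rV[R]_4) (d : R)
    (eta : 'rV[R]_4 -> 'rV[R]_4) (k : R) : Prop :=
  [/\ smooth_near (Q2 nu C w d) eta,
      forall p, Q2 nu C w d p ->
        tangent_M3 nu p (eta p) /\ ip nu (eta p) (eta p) = 1,
      forall p Y, Q2 nu C w d p -> tangent_Q2 nu w p Y ->
        ip nu (eta p) Y = 0 &
      forall p Y, Q2 nu C w d p -> tangent_Q2 nu w p Y ->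
        nabla nu C eta p Y = - k *: Y].

(* delta : I -> Q^2 is arclength parametrized, with unit normal Nd and geodesic
   curvature kd in Q^2.  The Gauss formulas turn the last equation into
   delta'' = k eta - C delta + kd Nd. *)
Definition Q2_curve (R : realType) (nu : bool) (C : R) (w : 'rV[R]_4) (d : R)
    (eta : 'rV[R]_4 -> 'rV[R]_4) (I : set R) (delta Nd : R -> 'rV[R]_4)
    (kd : R -> R) : Prop :=
  [/\ smooth_on I delta, smooth_on I Nd,
      forall t, I t ->
        Q2 nu C w d (delta t) /\ ip nu (derive1 delta t) (derive1 delta t) = 1,
      forall t, I t ->
        [/\ tangent_Q2 nu w (delta t) (Nd t), ip nu (Nd t) (Nd t) = 1 &
            ip nu (Nd t) (derive1 delta t) = 0] &
      forall t, I t ->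
        surf_covD nu C delta (eta \o delta) (derive1 delta) t = kd t *: Nd t].

(* M^3(C) is connected, so its two orientations are the signs of
   +/- det (p, u, v, w) on frames (u, v, w) of T_p M^3(C). *)
Definition positive_frame (R : realType) (o : bool) (p u v w : 'rV[R]_4) :
    Prop :=
  0 < (-1) ^+ o * \det (\matrix_(i < 4) [:: p; u; v; w]`_i).

(* (T, N, B) is the Frenet frame, kappa the curvature and tau the torsion, in
   M^3(C) with orientation o, of the arclength parametrized curve gamma. *)
Definition frenet (R : realType) (nu : bool) (C : R) (o : bool) (L : set R)
    (gamma : R -> 'rV[R]_4) (kappa tau : R -> R) (T N B : R -> 'rV[R]_4) :
    Prop :=
  [/\ [/\ smooth_on L T, smooth_on L N & smooth_on L B],
      forall s, L s ->
        [/\ T s = derive1 gamma s, tangent_M3 nu (gamma s) (T s),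
            tangent_M3 nu (gamma s) (N s) & tangent_M3 nu (gamma s) (B s)],
      forall s, L s ->
        [/\ ip nu (T s) (T s) = 1, ip nu (N s) (N s) = 1 &
            ip nu (B s) (B s) = 1] /\
        [/\ ip nu (T s) (N s) = 0, ip nu (T s) (B s) = 0 &
            ip nu (N s) (B s) = 0],
      forall s, L s -> positive_frame o (gamma s) (T s) (N s) (B s) &
      forall s, L s ->
        [/\ covD nu C gamma T s = kappa s *: N s,
            covD nu C gamma N s = - kappa s *: T s + tau s *: B s &
            covD nu C gamma B s = - tau s *: N s]].

Definition geodesic (R : realType) (nu : bool) (C : R) (L : set R)
    (gamma n : R -> 'rV[R]_4) : Prop :=
  forall s, L s -> surf_covD nu C gamma n (derive1 gamma) s = 0.

Definition angle_system (R : realType) (C r a k : R) (kd : R -> R)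
    (E : R -> R -> R) (L : set R) (t z theta : R -> R) : Prop :=
  forall s, L s ->
    [/\ derivable theta s 1,
        derive1 t s * Num.sqrt (E (t s) (z s)) = sin (theta s),
        derive1 z s = cos (theta s) &
        derive1 theta s = derive1 t s *
          (C * r * gC C (z s / r) +
           fC C (z s / r) * (sin a * k + cos a * kd (t s)))].

(* Main.v *)
(* Along gamma, the vectors T = T_delta, Z = X_z and N form an orthonormal frame
   of M^3(C), and gamma' = P T + z' Z with P = t' sqrt E and P^2 + z'^2 = 1.  As
   <T_delta', X_z> is the factor A multiplying t' in the equation for theta', the
   tangential acceleration is (P' - t' A z') T + (z'' + t' A P) Z.  So gamma is a
   geodesic iff the unit vector (z', P) rotates at speed t' A, and theta is the
   angle of that vector, namely a primitive of t' A with a suitable initial value.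
   The curvature is <gamma'', N> = - <gamma', N'> and the torsion is <N', B>,
   where N' = t' (sin a kappa_delta - k cos a) T and the orientation forces
   B = cos theta T - sin theta Z. *)
Require Import Defs.
From HB Require Import structures.
From mathcomp Require Import all_boot all_order all_algebra.
From mathcomp Require Import all_classical all_reals all_analysis.
From mathcomp Require Import ring lra.

Set Implicit Arguments.
Unset Strict Implicit.
Unset Printing Implicit Defensive.

Import Order.TTheory GRing.Theory Num.Theory.
Import numFieldNormedType.Exports.

Local Open Scope ring_scope.
Local Open Scope classical_set_scope.

(** * Derivatives of matrix-valued maps *)

Lemma is_derive_mxP (R : realFieldType) (V : normedModType R) m n
    (M : V -> 'M[R]_(m, n)) (dM : 'M[R]_(m, n)) t v :
  is_derive t v M dM <-> forall i j, is_derive t v (fun x => M x i j) (dM i j).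
Proof.
split=> [[dMt <-] i j|Mt].
  apply: DeriveDef; first exact: (derivable_mxP M t v).1.
  by rewrite derive_mx// mxE.
have dMt : derivable M t v by apply/derivable_mxP => i j; have [] := Mt i j.
apply: DeriveDef => //; apply/matrixP => i j.
by rewrite derive_mx// mxE; have [_ ->] := Mt i j.
Qed.

Lemma is_derive_scalemx (R : realFieldType) (V : normedModType R) m n
    (c : V -> R) (M : V -> 'M[R]_(m, n)) dc dM t v :
  is_derive t v c dc -> is_derive t v M dM ->
  is_derive t v (fun x => c x *: M x) (dc *: M t + c t *: dM).
Proof.
move=> ct /is_derive_mxP Mt; apply/is_derive_mxP => i j.
rewrite [X in is_derive _ _ X _](_ : _ = c * (fun x => M x i j)); last first.
  by apply/funext => x; rewrite mxE.
apply: is_derive_eq.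
by rewrite !mxE /GRing.scale/= addrC [dc * _]mulrC.
Qed.

Lemma is_derive_reparam (R : realType) (W : normedModType R) (F : R -> W)
    (g : R -> R) dF dg s :
  is_derive (g s) 1 F dF -> is_derive s 1 g dg ->
  is_derive s 1 (fun x => F (g x)) (dg *: dF).
Proof.
move=> [/derivable1_diffP Fg <-] [/derivable1_diffP gs <-].
have cFg : differentiable (F \o g) s by exact: differentiable_comp.
apply: DeriveDef; first exact/derivable1_diffP.
rewrite deriveE// diff_comp//= [in RHS]deriveE// [in RHS]deriveE//.
by rewrite -linearZ/= /GRing.scale/= mulr1.
Qed.

(** Chain rule that links the directional derivatives inside [nabla] with derivatives along a
    curve. *)
Lemma is_derive_along (R : realType) (V W : normedModType R) (F : V -> W)
    (c : R -> V) dc s :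
  differentiable F (c s) -> is_derive s 1 c dc ->
  is_derive s 1 (fun x => F (c x)) ('D_dc F (c s)).
Proof.
move=> Fc [/derivable1_diffP cs <-].
have cFc : differentiable (F \o c) s by exact: differentiable_comp.
apply: DeriveDef; first exact/derivable1_diffP.
by rewrite deriveE// diff_comp//= -deriveE// -deriveE.
Qed.

Lemma derive1_is_derive (R : realType) (W : normedModType R) (F : R -> W) (s : R) dF :
  is_derive s 1 F dF -> derive1 F s = dF.
Proof. by move=> [_ <-]; rewrite derive1E. Qed.

Lemma derivable_is_derive1 (R : realType) (W : normedModType R) (F : R -> W) (s : R) :
  derivable F s 1 -> is_derive s 1 F (derive1 F s).
Proof. by move=> Fs; rewrite derive1E; apply: derivableP. Qed.

(** Derivatives are local, so identities known only on the open parameter set may be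
    differentiated. *)
Lemma open_eq_is_derive (R : realType) (V W : normedModType R) (A : set V)
    (F G : V -> W) x v dF :
  open A -> A x -> (forall y, A y -> F y = G y) ->
  is_derive x v F dF -> is_derive x v G dF.
Proof.
move=> oA Ax FG; apply: near_eq_is_derive.
by near=> y; apply: FG; near: y; exact: open_nbhs_nbhs.
Unshelve. all: by end_near. Qed.

(** * The functions f and g, circular or hyperbolic according to the sign of [C] *)

Section fC_gC.
Variables (R : realType) (nu : bool) (C : R).
Hypothesis C_sign : (0 < C) = ~~ nu.

Lemma fCE : fC C = if nu then @cosh R else cos.
Proof. by apply/funext => x; rewrite /fC C_sign; case: nu. Qed.

Lemma gCE : gC C = if nu then @sinh R else sin.
Proof. by apply/funext => x; rewrite /gC C_sign; case: nu. Qed.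

Lemma is_derive_fC (x : R) : is_derive x 1 (fC C) (- (-1) ^+ nu * gC C x).
Proof.
rewrite fCE gCE; case: nu; last first.
  rewrite expr0 mulN1r. exact: is_derive_cos.
rewrite expr1 opprK mul1r.
rewrite [X in is_derive _ _ X _](_ : _ = 2^-1 *: (expR + (expR \o -%R))); last first.
  by rewrite funeqE => y; exact: mulrC.
apply: is_derive_eq; rewrite /sinh/= /GRing.scale/=; ring.
Qed.

Lemma is_derive_gC (x : R) : is_derive x 1 (gC C) (fC C x).
Proof.
rewrite fCE gCE; case: nu; last exact: is_derive_sin.
rewrite [X in is_derive _ _ X _](_ : _ = 2^-1 *: (expR - (expR \o -%R))); last first.
  by rewrite funeqE => y; exact: mulrC.
apply: is_derive_eq; rewrite /cosh/= /GRing.scale/=; ring.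
Qed.

Lemma fC2DgC2 (x : R) : fC C x ^+ 2 + (-1) ^+ nu * gC C x ^+ 2 = 1.
Proof.
rewrite fCE gCE; case: nu; last by rewrite expr0 mul1r cos2Dsin2.
have e1 : expR x * expR (- x) = 1 :> R by rewrite -expRD subrr expR0.
rewrite /cosh /sinh expr1.
transitivity (expR x * expR (- x)); last by [].
by field.
Qed.

End fC_gC.

(** * Primitives and angle functions *)

(** The oriented integral from a fixed point works: near each [s] it agrees up to a constant with an
    integral from some [b < s], to which the fundamental theorem on a segment applies. *)
Lemma open_interval_primitive (R : realType) (L : set R) (f : R -> R) :
  open_interval L -> {in L, continuous f} ->
  exists F : R -> R, forall s, L s -> is_derive s 1 F (f s).
Proof.
move=> [oL iL] fL.
have [->|/set0P[s0 Ls0]] := eqVneq L set0; first by exists f.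
pose mu := @lebesgue_measure R.
pose int b c := \int[mu]_(x in `[b, c]) f x.
have fint b c : L b -> L c -> mu.-integrable `[b, c] (EFin \o f).
  move=> Lb Lc; apply: continuous_compact_integrable; first exact: segment_compact.
  apply: continuous_in_subspaceT => x; rewrite inE/= in_itv/= => bxc.
  by apply: fL; rewrite inE; apply: iL bxc.
have intB b x y : L b -> L y -> b <= x -> x <= y -> int b y - int b x = int x y.
  move=> Lb Ly bx xy; have Lx : L x by apply: (iL _ _ Lb Ly); rewrite bx.
  rewrite /int Rintegral_itvB ?bnd_simp//; last exact: fint.
  apply: Rintegral_itv_obnd_cbnd; apply: integrableS (fint _ _ Lx Ly) => //.
  exact: subset_itv_oc_cc.
have int0 x y : y <= x -> int x y = 0.
  rewrite le_eqVlt => /predU1P[->|yx].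
    by rewrite /int set_itv1 Rintegral_set1.
  by rewrite /int set_itv_ge ?Rintegral_set0// bnd_simp -ltNge.
(* [int x y] vanishes for [y <= x], so this is the oriented integral. *)
pose F x := int s0 x - int x s0; exists F => s Ls.
(* A base point [b] to the left of both [x] and [s0] may replace [s0]: this changes [F] only by a
   constant. *)
have FE b x : L b -> L x -> b <= x -> b <= s0 -> F x = int b x - int b s0.
  move=> Lb Lx bx bs0; rewrite /F; have [s0x|/ltW xs0] := leP s0 x.
    by rewrite (int0 _ _ s0x) subr0 intB.
  by rewrite (int0 _ _ xs0) sub0r -(intB b) // opprB.
have [e /= e0 eL] := (nbhs_ballP _ _).1 (open_nbhs_nbhs (conj oL Ls)).
have near_in y : `|s - y| < e -> L y by move=> sy; apply: eL; rewrite /ball/=.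
have Lse : L (s - e / 2).
  by apply: near_in; rewrite opprB addrC subrK ger0_norm; lra.
have Lu : L (s + e / 2).
  by apply: near_in; rewrite opprD addrA subrr add0r normrN ger0_norm; lra.
(* To the left of [s0] and of the whole ball of radius [e / 2] about [s], so that [FE] applies
   throughout that ball. *)
pose b := Num.min s0 (s - e / 2).
have Lb : L b by rewrite /b /Num.min; case: ifP.
have bs : b < s by rewrite /b gt_min; apply/orP; right; lra.
have [dG GE] : derivable (int b) s 1 /\ (int b)^`() s = f s.
  apply: (@continuous_FTC1_closed _ f b s (s + e / 2)) => //; [lra|exact: fint|].
  by apply: fL; rewrite inE.
apply: (@open_eq_is_derive _ _ _ (ball s (e / 2)) (fun x => int b x - int b s0)).
- exact: ball_open.
- by apply: ballxx; lra.
- move=> y /=; rewrite /ball/= => sy.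
  have Ly : L y by apply: near_in; lra.
  rewrite (FE b)// /b ge_min; last by rewrite lexx.
  by apply/orP; right; move: sy; rewrite ltr_norml => /andP[]; lra.
- rewrite -GE; apply: is_derive_eq (subr0 _).
  by apply: is_deriveB; exact: derivable_is_derive1.
Qed.

Lemma is_derive0_eq (R : realType) (L : set R) (f : R -> R) :
  is_interval L -> (forall s, L s -> is_derive s 1 f 0) ->
  forall x y, L x -> L y -> f x = f y.
Proof.
move=> iL f0 x y Lx Ly.
wlog xy : x y Lx Ly / x <= y.
  by move=> H; have [/H->|/ltW/H->] := leP x y.
have xyL u : u \in `[x, y]%R -> L u by rewrite in_itv/=; apply: iL.
have df u : u \in `]x, y[%R -> is_derive u 1 f (cst 0 u).
  by move=> uxy; apply: f0; apply: xyL; apply: subset_itv_oo_cc.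
have cf : {within `[x, y], continuous f}.
  by apply: derivable_within_continuous => u /xyL/f0 [].
by have [u _ /eqP] := MVT_segment xy df cf; rewrite mul0r subr_eq0 => /eqP.
Qed.

(** [acos q] has the right cosine and a nonnegative sine; the sign of [p] decides between it and its
    opposite. *)
Lemma circle_angle (R : realType) (p q : R) :
  p ^+ 2 + q ^+ 2 = 1 -> exists x : R, p = sin x /\ q = cos x.
Proof.
move=> pq1.
have q1 : -1 <= q <= 1 by have := sqr_ge0 p => p0; apply/andP; split; nra.
have sE : sin (acos q) = `|p| by rewrite sin_acos// -pq1 addrK sqrtr_sqr.
have [p0|p0] := leP 0 p.
  by exists (acos q); rewrite acosK ?in_itv// sE ger0_norm.
by exists (- acos q); rewrite cosN sinN acosK ?in_itv// sE ltr0_norm ?opprK.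
Qed.

(** Take for [theta] a primitive of [omega], normalised at one point. Then ([q], [p]) and (cos
    theta, sin theta) obey the same rotation equation, so the angle between them stays constant. *)
Lemma angle_lift (R : realType) (L : set R) (p q omega : R -> R) :
  open_interval L -> {in L, continuous omega} ->
  (forall s, L s -> p s ^+ 2 + q s ^+ 2 = 1) ->
  (forall s, L s -> is_derive s 1 p (omega s * q s)) ->
  (forall s, L s -> is_derive s 1 q (- omega s * p s)) ->
  exists theta : R -> R, forall s, L s ->
    [/\ is_derive s 1 theta (omega s), p s = sin (theta s) & q s = cos (theta s)].
Proof.
move=> oiL cw pq1 dp dq.
have [F dF] := open_interval_primitive oiL cw.
have [->|/set0P[s0 Ls0]] := eqVneq L set0; first by exists omega.
have [x [px qx]] := circle_angle (pq1 _ Ls0).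
pose theta s := F s + (x - F s0); exists theta => s Ls.
have dtheta y : L y -> is_derive y 1 theta (omega y).
  by move=> Ly; have := dF y Ly => ?; apply: is_derive_eq (addr0 _).
have dsin y : L y -> is_derive y 1 (sin \o theta) (cos (theta y) * omega y).
  by move=> Ly; have := dtheta y Ly => ?; apply: is_derive1_comp.
have dcos y : L y -> is_derive y 1 (cos \o theta) (- sin (theta y) * omega y).
  by move=> Ly; have := dtheta y Ly => ?; apply: is_derive1_comp.
have [_ iL] := oiL.
(* [u] and [v] are the sine and cosine of the angle from (cos theta, sin theta) to ([q], [p]); both
   have zero derivative, and at [s0] they are 0 and 1. *)
pose u := p * (cos \o theta) - q * (sin \o theta).
pose v := p * (sin \o theta) + q * (cos \o theta).
have u0 : u s = u s0.
  apply: (@is_derive0_eq _ L u iL _ _ _ Ls Ls0) => y Ly.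
  apply: is_derive_eq (is_deriveB (is_deriveM (dp y Ly) (dcos y Ly))
    (is_deriveM (dq y Ly) (dsin y Ly))) _.
  by rewrite /GRing.scale/=; ring.
have v0 : v s = v s0.
  apply: (@is_derive0_eq _ L v iL _ _ _ Ls Ls0) => y Ly.
  apply: is_derive_eq (is_deriveD (is_deriveM (dp y Ly) (dsin y Ly))
    (is_deriveM (dq y Ly) (dcos y Ly))) _.
  by rewrite /GRing.scale/=; ring.
have th0 : theta s0 = x by rewrite /theta addrC subrK.
have {}u0 : p s * cos (theta s) - q s * sin (theta s) = 0.
  by move: u0; rewrite /u !fctE /= th0 px qx => ->; ring.
have {}v0 : p s * sin (theta s) + q s * cos (theta s) = 1.
  by move: v0; rewrite /v !fctE /= th0 px qx => ->; rewrite -(cos2Dsin2 x); ring.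
have cs := cos2Dsin2 (theta s).
split; first exact: dtheta.
(* Inverting the rotation by [theta] recovers [p] and [q] from [u] and [v]. *)
- transitivity (p s * (cos (theta s) ^+ 2 + sin (theta s) ^+ 2)).
    by rewrite cs mulr1.
  transitivity (cos (theta s) * (p s * cos (theta s) - q s * sin (theta s)) +
    sin (theta s) * (p s * sin (theta s) + q s * cos (theta s))); first by ring.
  by rewrite u0 v0; ring.
- transitivity (q s * (cos (theta s) ^+ 2 + sin (theta s) ^+ 2)).
    by rewrite cs mulr1.
  transitivity (- sin (theta s) * (p s * cos (theta s) - q s * sin (theta s)) +
    cos (theta s) * (p s * sin (theta s) + q s * cos (theta s))); first by ring.
  by rewrite u0 v0; ring.
Qed.

(** * Orthonormal frames for the flat metric *)

(** Weights put the first coordinate on the same footing as the others, so bilinearity and the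
    product rule are checked term by term. *)
Lemma ipE (R : realType) nu (u v : 'rV[R]_4) :
  ip nu u v = \sum_(i < 4) (if i == 0 then (-1) ^+ nu else 1) * u 0 i * v 0 i.
Proof.
rewrite /ip [RHS](bigD1 ord0)//=; congr (_ + _).
by apply: eq_bigr => i /negPf ->; rewrite mul1r.
Qed.

Lemma ipC (R : realType) nu (u v : 'rV[R]_4) : ip nu u v = ip nu v u.
Proof. by rewrite !ipE; apply: eq_bigr => i _; rewrite mulrAC. Qed.

Lemma ipDl (R : realType) nu (u v x : 'rV[R]_4) :
  ip nu (u + v) x = ip nu u x + ip nu v x.
Proof.
rewrite !ipE -big_split; apply: eq_bigr => i _.
by rewrite mxE mulrDr mulrDl.
Qed.

Lemma ipZl (R : realType) nu c (u x : 'rV[R]_4) : ip nu (c *: u) x = c * ip nu u x.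
Proof.
rewrite !ipE mulr_sumr; apply: eq_bigr => i _.
by rewrite mxE !mulrA [_ * c]mulrC.
Qed.

Lemma ipDr (R : realType) nu (x u v : 'rV[R]_4) :
  ip nu x (u + v) = ip nu x u + ip nu x v.
Proof. by rewrite ipC ipDl ![ip _ _ x]ipC. Qed.

Lemma ipZr (R : realType) nu c (x u : 'rV[R]_4) : ip nu x (c *: u) = c * ip nu x u.
Proof. by rewrite ipC ipZl ipC. Qed.

Lemma ipNl (R : realType) nu (u x : 'rV[R]_4) : ip nu (- u) x = - ip nu u x.
Proof. by rewrite -scaleN1r ipZl mulN1r. Qed.

Lemma ipNr (R : realType) nu (x u : 'rV[R]_4) : ip nu x (- u) = - ip nu x u.
Proof. by rewrite ipC ipNl ipC. Qed.

Lemma ip0l (R : realType) nu (x : 'rV[R]_4) : ip nu 0 x = 0.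
Proof. by rewrite -(scale0r 0) ipZl mul0r. Qed.

Definition ipbi := (ipDl, ipDr, ipNl, ipNr, ipZl, ipZr).

Lemma is_derive_ip (R : realType) nu (u v : R -> 'rV[R]_4) du dv (s : R) :
  is_derive s 1 u du -> is_derive s 1 v dv ->
  is_derive s 1 (fun x => ip nu (u x) (v x)) (ip nu du (v s) + ip nu (u s) dv).
Proof.
move=> /is_derive_mxP us /is_derive_mxP vs.
pose g (i : 'I_4) : R := if i == 0 then (-1) ^+ nu else 1.
rewrite [X in is_derive _ _ X _](_ : _ =
    \sum_(i < 4) g i *: ((fun x => u x 0 i) * (fun x => v x 0 i))); last first.
  by apply/funext => x; rewrite ipE fct_sumE; apply: eq_bigr => i _; rewrite -mulrA.
have dg i := is_deriveZ (g i) (is_deriveM (us 0 i) (vs 0 i)).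
apply: is_derive_eq (is_derive_sum dg) _.
rewrite !ipE -big_split; apply: eq_bigr => i _.
by rewrite /GRing.scale/= -/(g i); ring.
Qed.

Section frame.
Variables (R : realType) (nu : bool) (C : R) (p e1 e2 e3 : 'rV[R]_4).
Hypotheses (pp : C * ip nu p p = 1) (pe1 : ip nu p e1 = 0)
  (pe2 : ip nu p e2 = 0) (pe3 : ip nu p e3 = 0).
Hypotheses (e11 : ip nu e1 e1 = 1) (e12 : ip nu e1 e2 = 0)
  (e13 : ip nu e1 e3 = 0) (e22 : ip nu e2 e2 = 1) (e23 : ip nu e2 e3 = 0)
  (e33 : ip nu e3 e3 = 1).

Let e (i : 'I_4) := [:: p; e1; e2; e3]`_i.

Let ord4E (Q : 'I_4 -> Prop) :
  Q ord0 -> Q (lift ord0 ord0) -> Q (lift ord0 (lift ord0 ord0)) ->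
  Q (lift ord0 (lift ord0 (lift ord0 ord0))) -> forall i, Q i.
Proof.
move=> Q0 Q1 Q2 Q3 [[|[|[|[|//]]]] i4].
- by rewrite (_ : Ordinal _ = ord0)//; exact: val_inj.
- by rewrite (_ : Ordinal _ = lift ord0 ord0)//; exact: val_inj.
- by rewrite (_ : Ordinal _ = lift ord0 (lift ord0 ord0))//; exact: val_inj.
- by rewrite (_ : Ordinal _ = lift ord0 (lift ord0 (lift ord0 ord0)))//; exact: val_inj.
Qed.

(** The Gram matrix [B *m A^T] is diagonal with nonzero entries, whatever the signature, so [B] is
    invertible; the hypotheses say that [B *m v^T = 0]. *)
Lemma frame_eq0 (v : 'rV[R]_4) : ip nu p v = 0 -> ip nu e1 v = 0 ->
  ip nu e2 v = 0 -> ip nu e3 v = 0 -> v = 0.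
Proof.
move=> pv e1v e2v e3v.
pose A := \matrix_(i < 4) e i.
(* Row [i] of [B] represents the linear form <e_i, .>, with the metric weights absorbed. *)
pose B := \matrix_(i < 4, j < 4)
  ((if j == 0 then (-1) ^+ nu else 1) * e i 0 j : R).
have BA : B *m A^T = diag_mx (\row_i ip nu (e i) (e i)).
  apply/matrixP => i j; rewrite !mxE.
  transitivity (ip nu (e i) (e j)).
    by rewrite ipE; apply: eq_bigr => l _; rewrite !mxE.
  elim/ord4E: i; elim/ord4E: j;
    by rewrite /e/= ?mulr1n ?mulr0n// ipC.
have uB : B \in unitmx.
  pose D := diag_mx (\row_i (ip nu (e i) (e i))^-1).
  suff /mulmx1_unit[] : B *m (A^T *m D) = 1%:M by [].
  rewrite mulmxA BA mulmx_diag; apply/matrixP => i j; rewrite !mxE.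
  congr (_ *+ _); apply: divff.
  have pp0 : ip nu p p != 0.
    by apply: contra_eq_neq pp => ->; rewrite mulr0 eq_sym oner_neq0.
  by elim/ord4E: i; rewrite /e/= ?e11 ?e22 ?e33 ?oner_neq0.
have Bv : B *m v^T = 0.
  apply/matrixP => i j; rewrite !mxE.
  transitivity (ip nu (e i) v).
    by rewrite ipE; apply: eq_bigr => l _; rewrite !mxE [j]ord1.
  by elim/ord4E: i; rewrite /e.
apply: trmx_inj; rewrite trmx0.
by rewrite -(mulKmx uB v^T) Bv mulmx0.
Qed.

(** The difference of the two sides is orthogonal to all four frame vectors. The coefficient of [p]
    carries [C] because <p, p> = 1/C. *)
Lemma frame_expansion (y : 'rV[R]_4) :
  y = (C * ip nu y p) *: p + ip nu y e1 *: e1 + ip nu y e2 *: e2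
    + ip nu y e3 *: e3.
Proof.
apply/eqP; rewrite -subr_eq0; apply/eqP; apply: frame_eq0.
- rewrite !ipbi pe1 pe2 pe3 (ipC _ y p) !mulr0 !addr0.
  by rewrite mulrAC pp mul1r subrr.
- by rewrite !ipbi (ipC _ e1 p) pe1 e11 e12 e13 (ipC _ y e1); ring.
- by rewrite !ipbi (ipC _ e2 p) (ipC _ e2 e1) pe2 e12 e22 e23 (ipC _ y e2); ring.
- rewrite !ipbi (ipC _ e3 p) (ipC _ e3 e1) (ipC _ e3 e2) pe3 e13 e23 e33.
  by rewrite (ipC _ y e3); ring.
Qed.

End frame.

(** Used to compare orientations: [s], [c] will be the components of gamma' and [a], [b] those of
    the binormal in the basis (T, X_z). *)
Lemma det_frame_rotation (R : realType) (p u v x : 'rV[R]_4) (a b c s : R) :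
  \det (\matrix_(i < 4) [:: p; s *: u + c *: v; x; a *: u + b *: v]`_i) =
  (c * a - s * b) * \det (\matrix_(i < 4) [:: p; u; v; x]`_i).
Proof.
pose M : 'M[R]_4 := \matrix_(i, j)
  (nth [::] [:: [:: 1; 0; 0; 0]; [:: 0; s; c; 0]; [:: 0; 0; 0; 1];
                [:: 0; a; b; 0]] i)`_j.
have -> : \matrix_(i < 4) [:: p; s *: u + c *: v; x; a *: u + b *: v]`_i =
    M *m \matrix_(i < 4) [:: p; u; v; x]`_i.
  apply/matrixP => i j; rewrite !mxE !big_ord_recl big_ord0 !mxE /=.
  case: i => [[|[|[|[|//]]]] i4] /=; rewrite ?mxE; ring.
rewrite det_mulmx; congr (_ * _).
(* Two expansions along rows of [M] with a single nonzero entry leave a 2 by 2 determinant. *)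
rewrite (expand_det_row _ ord0) !big_ord_recl big_ord0 !mxE /= !mul0r !addr0 mul1r.
rewrite /cofactor (expand_det_row _ (lift ord0 ord0)) !big_ord_recl big_ord0 !mxE /=.
rewrite !mul0r !add0r addr0 mul1r /cofactor.
rewrite (expand_det_row _ ord0) !big_ord_recl big_ord0 /cofactor !det_mx11 !mxE /=.
by rewrite /bump /=; ring.
Qed.

(** * Curves in a totally umbilical surface *)

(** Product rule for a constant scalar product; it yields the components of the derivatives of all
    frame vectors below. *)
Lemma ip_cst_derive (R : realType) nu (A : set R) (u v : R -> 'rV[R]_4) du dv c s :
  open A -> A s -> (forall x, A x -> ip nu (u x) (v x) = c) ->
  is_derive s 1 u du -> is_derive s 1 v dv ->
  ip nu du (v s) + ip nu (u s) dv = 0.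
Proof.
move=> oA As uvc us vs.
have [_ <-] := is_derive_ip nu us vs.
have cst0 : is_derive s 1 (cst c) 0 by exact: is_derive_cst.
have uvc' x : A x -> cst c x = ip nu (u x) (v x) by move=> /uvc.
by have [_ ->] := open_eq_is_derive oA As uvc' cst0.
Qed.

Lemma smooth_is_derive1 (R : realType) (W : normedModType R) (A : set R)
    (F : R -> W) s :
  smooth_on A F -> A s -> is_derive s 1 F (derive1 F s).
Proof.
by move=> sF /(sF [::]) /derivable1_diffP /derivable_is_derive1.
Qed.

(** [foldr] applies the last direction of the list first, so differentiating [F] beforehand amounts
    to appending 1 to the list. *)
Lemma smooth_derive1 (R : realType) (W : normedModType R) (A : set R)
    (F : R -> W) : smooth_on A F -> smooth_on A (derive1 F).
Proof.
move=> sF vs p Ap; rewrite (_ : derive1 F = 'D_1 F); last first.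
  by apply/funext => x; rewrite derive1E.
by have := sF (rcons vs 1) p Ap; rewrite -cats1 foldr_cat.
Qed.

Section moving_frame.
Variables (R : realType) (nu : bool) (C : R) (C_neq0 : C != 0).
Variables (w : 'rV[R]_4) (d : R) (eta : 'rV[R]_4 -> 'rV[R]_4) (k : R).
Hypothesis hQ : Q2_normal nu C w d eta k.
Variables (I : set R) (oI : open I) (delta Nd : R -> 'rV[R]_4) (kd : R -> R).
Hypothesis hdelta : Q2_curve nu C w d eta I delta Nd kd.

Local Notation T := (derive1 delta).
Local Notation etad t := (eta (delta t)).

Lemma is_derive_delta t : I t -> is_derive t 1 delta (T t).
Proof. by have [sd _ _ _ _] := hdelta; apply: smooth_is_derive1. Qed.

Lemma M3_delta t : I t -> ip nu (delta t) (delta t) = C^-1.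
Proof. by have [_ _ qd _ _] := hdelta => /qd[[[]]]. Qed.

(** Differentiate <delta, delta> = 1/C and <delta, w> = d. *)
Lemma tangent_T t : I t -> tangent_Q2 nu w (delta t) (T t).
Proof.
move=> It; have dd := is_derive_delta It; split.
  have := ip_cst_derive oI It M3_delta dd dd.
  by rewrite (ipC _ (delta t)) -mulr2n => /eqP; rewrite mulrn_eq0/= => /eqP.
have dw : is_derive t 1 (cst w) 0 by apply: is_derive_cst.
have dw' x : I x -> ip nu (delta x) (cst w x) = d.
  by have [_ _ qd _ _] := hdelta => /qd[[]].
by have := ip_cst_derive oI It dw' dd dw; rewrite (ipC _ _ 0) ip0l addr0.
Qed.

Lemma moving_frame_gram t : I t ->
  [/\ ip nu (delta t) (T t) = 0, ip nu (delta t) (Nd t) = 0 &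
      ip nu (delta t) (etad t) = 0] /\
  [/\ ip nu (T t) (Nd t) = 0, ip nu (T t) (etad t) = 0 &
      ip nu (Nd t) (etad t) = 0] /\
  [/\ ip nu (T t) (T t) = 1, ip nu (Nd t) (Nd t) = 1 &
      ip nu (etad t) (etad t) = 1].
Proof.
move=> It; have [_ _ /(_ t It)[Qt TT] /(_ t It)[tN NN NT] _] := hdelta.
have [_ /(_ _ Qt)[te ee] eY _] := hQ.
have tT := tangent_T It; have [dT _] := tT; have [dN _] := tN.
split; first by rewrite !(ipC _ (delta t)).
split; last by [].
by split; rewrite ipC//; apply: eY.
Qed.

(** The flat derivative of [eta] along [delta] is already tangent to M^3(C): differentiating <eta,
    delta> = 0 and using <eta, T> = 0 kills its [delta] component, so it coincides with [nabla]. *)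
Lemma is_derive_eta t : I t ->
  is_derive t 1 (fun x => etad x) (- k *: T t).
Proof.
move=> It; have [_ _ /(_ t It)[Qt TT] _ _] := hdelta.
have [[U [oU QU sU]] te _ nab] := hQ.
have dd := is_derive_delta It.
have de := is_derive_along (sU [::] _ (QU _ Qt)) dd.
apply: (is_derive_eq de); rewrite /= -(nab _ _ Qt (tangent_T It)) /nabla /proj_M3.
have := ip_cst_derive (nu := nu) (c := 0) oI It _ de dd; rewrite /=.
have [_ [[_ Te _] _]] := moving_frame_gram It.
rewrite (ipC _ (etad t)) Te addr0 => ->; first by rewrite mulr0 scale0r subr0.
by move=> x Ix; rewrite ipC; have [[]] := moving_frame_gram Ix.
Qed.

(** The components along [delta] and [eta] come from differentiating <T, delta> = 0 and <T, eta> =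
    0; what remains is the covariant derivative in Q^2, which is [kd t *: Nd t]. *)
Lemma is_derive_T t : I t ->
  is_derive t 1 T (- C *: delta t + k *: etad t + kd t *: Nd t).
Proof.
move=> It; have [sd _ qd _ /(_ t It) cov] := hdelta.
have dd := is_derive_delta It; have de := is_derive_eta It.
have dT := smooth_is_derive1 (smooth_derive1 sd) It.
apply: (is_derive_eq dT); move: dT; set T' := derive1 T t => dT.
have [[dT0 dN0 de0] [[TN Te Ne] [TT NN ee]]] := moving_frame_gram It.
have Tdelta : ip nu T' (delta t) = - 1.
  apply/eqP; rewrite -addr_eq0 -TT; apply/eqP.
  apply: (ip_cst_derive (nu := nu) (c := 0) oI It _ dT dd) => x Ix.
  by rewrite ipC; have [[]] := moving_frame_gram Ix.
have Teta : ip nu T' (etad t) = k.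
  have := ip_cst_derive (nu := nu) (c := 0) oI It _ dT de; rewrite /= ipZr TT mulr1.
  move=> H; apply/eqP; rewrite -subr_eq0; apply/eqP; apply: H => x Ix.
  by have [_ [[]]] := moving_frame_gram Ix.
move: cov; rewrite /surf_covD /covD /proj_M3 -/T' /= Tdelta.
rewrite !ipbi Teta de0 mulr0 subr0 mulrN1 scaleNr opprK => <-.
by apply/rowP => i; rewrite !mxE; ring.
Qed.

(** Each component of Nd' is found by differentiating the scalar product of [Nd] with a frame
    vector; only the one along [T] survives. *)
Lemma is_derive_Nd t : I t -> is_derive t 1 Nd (- kd t *: T t).
Proof.
move=> It; have [_ sN _ _ _] := hdelta.
have dd := is_derive_delta It; have de := is_derive_eta It.
have dT := is_derive_T It.
have dN := smooth_is_derive1 sN It.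
apply: (is_derive_eq dN); move: dN; set N' := derive1 Nd t => dN.
have [[dT0 dN0 de0] [[TN Te Ne] [TT NN ee]]] := moving_frame_gram It.
have Ndelta : ip nu N' (delta t) = 0.
  have := ip_cst_derive (nu := nu) (c := 0) oI It _ dd dN; rewrite /= TN add0r ipC; apply.
  by move=> x Ix; have [[]] := moving_frame_gram Ix.
have NT : ip nu N' (T t) = - kd t.
  have := ip_cst_derive (nu := nu) (c := 0) oI It _ dT dN; rewrite /= !ipbi dN0.
  rewrite (ipC _ (etad t)) Ne NN !mulr0 !add0r mulr1 ipC => H.
  apply/eqP; rewrite -addr_eq0 addrC; apply/eqP; apply: H => x Ix.
  by have [_ [[]]] := moving_frame_gram Ix.
have Neta : ip nu N' (etad t) = 0.
  have := ip_cst_derive (nu := nu) (c := 0) oI It _ dN de; rewrite /= ipZr.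
  rewrite (ipC _ (Nd t)) TN mulr0 addr0; apply => x Ix.
  by have [_ [[]]] := moving_frame_gram Ix.
have NN' : ip nu N' (Nd t) = 0.
  have H x : I x -> ip nu (Nd x) (Nd x) = 1.
    by move=> Ix; have [_ [_ []]] := moving_frame_gram Ix.
  have := ip_cst_derive oI It H dN dN.
  by rewrite (ipC _ (Nd t)) -mulr2n => /eqP; rewrite mulrn_eq0/= => /eqP.
have Cdd : C * ip nu (delta t) (delta t) = 1 by rewrite M3_delta// divff.
rewrite (frame_expansion Cdd dT0 dN0 de0 TT TN Te NN Ne ee N').
by rewrite Ndelta NT NN' Neta mulr0 !scale0r add0r !addr0.
Qed.

(** On [I], [kd] equals <T', Nd>, whose factors are smooth. This will make the angular speed
    continuous. *)
Lemma derivable_kd t : I t -> derivable kd t 1.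
Proof.
move=> It; have [sd sN _ _ _] := hdelta.
have dN := smooth_is_derive1 sN It.
have dT' := smooth_is_derive1 (smooth_derive1 (smooth_derive1 sd)) It.
have := is_derive_ip nu dT' dN => dTN.
suff : is_derive t 1 kd
  (ip nu (derive1 (derive1 T) t) (Nd t) + ip nu (derive1 T t) (derive1 Nd t)) by [].
apply: open_eq_is_derive oI It _ dTN => x Ix.
have [[dT0 dN0 de0] [[TN Te Ne] [TT NN ee]]] := moving_frame_gram Ix.
rewrite (derive1_is_derive (is_derive_T Ix)) !ipbi dN0 (ipC _ (etad x)) Ne NN.
by ring.
Qed.

(** The surface, its rulings and its normal all have this shape, for different [u], [v], [al], [be],
    so one computation serves the three. *)
Lemma is_derive_ruled (al be : R) (t u v : R -> R) t' u' v' (s : R) :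
  I (t s) -> is_derive s 1 t t' -> is_derive s 1 u u' -> is_derive s 1 v v' ->
  is_derive s 1
    (fun x => u x *: delta (t x) + v x *: (al *: Nd (t x) + be *: etad (t x)))
    ((t' * (u s - v s * (be * k + al * kd (t s)))) *: T (t s) +
     (u' *: delta (t s) + v' *: (al *: Nd (t s) + be *: etad (t s)))).
Proof.
move=> Its dt du dv.
have dd := is_derive_reparam (is_derive_delta Its) dt.
have dn := is_derive_reparam (is_derive_Nd Its) dt.
have de := is_derive_reparam (is_derive_eta Its) dt.
have dU := is_deriveD (is_deriveZ al dn) (is_deriveZ be de).
apply: is_derive_eq (is_deriveD (is_derive_scalemx du dd) (is_derive_scalemx dv dU)) _.
by apply/rowP => i; rewrite !mxE; ring.
Qed.

End moving_frame.

(** * The ruled surface and its curves *)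

Section surface.
Variables (R : realType) (nu : bool) (C r : R).
Hypotheses (r_gt0 : 0 < r) (defC : C = (-1) ^+ nu / r ^+ 2).
Variables (w : 'rV[R]_4) (d : R) (eta : 'rV[R]_4 -> 'rV[R]_4) (k : R).
Hypothesis hQ : Q2_normal nu C w d eta k.
Variables (I : set R) (oI : open I) (delta Nd : R -> 'rV[R]_4) (kd : R -> R).
Hypothesis hdelta : Q2_curve nu C w d eta I delta Nd kd.
Variable a : R.

Local Notation T := (derive1 delta).
Local Notation f z := (fC C (z / r)).
Local Notation g z := (gC C (z / r)).

Definition ruled_surface (t z : R) : 'rV[R]_4 :=
  f z *: delta t + (r * g z) *: (cos a *: Nd t + sin a *: eta (delta t)).

(** This is X_z: as C r^2 = (-1)^nu, the derivative of f(z/r) is - C r g(z/r). *)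
Definition ruling (t z : R) : 'rV[R]_4 :=
  (- C * r * g z) *: delta t + f z *: (cos a *: Nd t + sin a *: eta (delta t)).

Definition surface_normal (t z : R) : 'rV[R]_4 :=
  - sin a *: Nd t + cos a *: eta (delta t).

(* [X_t = surface_speed *: T], so it is the square root of E where positive. *)
Definition surface_speed (t z : R) : R :=
  f z - r * g z * (sin a * k + cos a * kd t).

(** Equal to <T', X_z>, and also to minus the z-derivative of [surface_speed]. *)
Definition angle_rate (t z : R) : R :=
  C * r * g z + f z * (sin a * k + cos a * kd t).

Lemma curvature_neq0 : C != 0.
Proof. by rewrite defC mulf_neq0 ?signr_eq0// invr_eq0 expf_neq0// gt_eqF. Qed.

Lemma curvature_sign : (0 < C) = ~~ nu.
Proof.
have r2 : 0 < (r ^+ 2)^-1 by rewrite invr_gt0 exprn_gt0.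
by rewrite defC (pmulr_lgt0 _ r2) signr_gt0.
Qed.

Let Cr2 : C * r ^+ 2 = (-1) ^+ nu.
Proof. by rewrite defC divfK// expf_neq0// gt_eqF. Qed.

Let fg1 z : f z ^+ 2 + C * r ^+ 2 * g z ^+ 2 = 1.
Proof. by rewrite Cr2 fC2DgC2 ?curvature_sign. Qed.

(** Expanded in the moving frame of [delta], all entries follow from C C^-1 = 1, cos^2 + sin^2 = 1
    and f^2 + C r^2 g^2 = 1. *)
Lemma surface_frame_gram t z : I t ->
  let p := ruled_surface t z in let Z := ruling t z in
  let N := surface_normal t z in
  C * ip nu p p = 1 /\
  [/\ ip nu p (T t) = 0, ip nu p Z = 0 & ip nu p N = 0] /\
  [/\ ip nu (T t) Z = 0, ip nu (T t) N = 0 & ip nu Z N = 0] /\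
  [/\ ip nu (T t) (T t) = 1, ip nu Z Z = 1 & ip nu N N = 1].
Proof.
move=> It /=; rewrite /ruled_surface /ruling /surface_normal.
have C0 := curvature_neq0.
have [[dT dN de] [[TN Te Ne] [TT NN ee]]] := moving_frame_gram hQ oI hdelta It.
have dd := M3_delta hdelta It.
have cs := cos2Dsin2 a; have fg := fg1 z.
have CC : C * C^-1 = 1 by rewrite divff.
rewrite !ipbi !(ipC _ (T t) (delta t)) !(ipC _ (Nd t) (delta t))
  !(ipC _ (eta (delta t)) (delta t)) !(ipC _ (Nd t) (T t))
  !(ipC _ (eta (delta t)) (T t)) !(ipC _ (eta (delta t)) (Nd t)).
rewrite dd dT dN de TN Te Ne TT NN ee.
set x := f z in fg *; set y := g z in fg *.
set c := cos a in cs *; set s := sin a in cs *.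
split.
  transitivity (C * C^-1 * x ^+ 2 + C * r ^+ 2 * y ^+ 2 * (c ^+ 2 + s ^+ 2)).
    by ring.
  by rewrite CC cs mul1r mulr1.
split; [split; try ring|split; [split; ring|split=> //]].
- transitivity (r * x * y * ((c ^+ 2 + s ^+ 2) - C * C^-1)); first by ring.
  by rewrite CC cs subrr mulr0.
- transitivity ((C * C^-1) * (C * r ^+ 2 * y ^+ 2) + x ^+ 2 * (c ^+ 2 + s ^+ 2)).
    by ring.
  by rewrite CC cs mul1r mulr1 addrC.
- transitivity (c ^+ 2 + s ^+ 2); [by ring|exact: cs].
Qed.

Let is_derive_f (z : R -> R) z' (s : R) : is_derive s 1 z z' ->
  is_derive s 1 (fun x => f (z x)) (z' * (- C * r * g (z s))).
Proof.
move=> dz; have dzr : is_derive s 1 (fun x => z x / r) (r^-1 * z').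
  rewrite [X in is_derive _ _ X _](_ : _ = r^-1 *: z).
    exact: is_deriveZ.
  by apply/funext => x; rewrite mulrC.
have r0 : r != 0 by rewrite gt_eqF.
apply: is_derive_eq (is_derive_reparam (is_derive_fC curvature_sign _) dzr) _.
by rewrite /GRing.scale/= -Cr2; field.
Qed.

Let is_derive_g (z : R -> R) z' (s : R) : is_derive s 1 z z' ->
  is_derive s 1 (fun x => r * g (z x)) (z' * f (z s)).
Proof.
move=> dz; have dzr : is_derive s 1 (fun x => z x / r) (r^-1 * z').
  rewrite [X in is_derive _ _ X _](_ : _ = r^-1 *: z).
    exact: is_deriveZ.
  by apply/funext => x; rewrite mulrC.
have r0 : r != 0 by rewrite gt_eqF.
apply: is_derive_eq (is_deriveZ r (is_derive_reparam (is_derive_gC curvature_sign _) dzr)) _.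
by rewrite /GRing.scale/=; field.
Qed.

Lemma is_derive_surface (t z : R -> R) t' z' (s : R) : I (t s) ->
  is_derive s 1 t t' -> is_derive s 1 z z' ->
  is_derive s 1 (fun x => ruled_surface (t x) (z x))
    ((t' * surface_speed (t s) (z s)) *: T (t s) + z' *: ruling (t s) (z s)).
Proof.
move=> Its dt dz.
apply: is_derive_eq (is_derive_ruled curvature_neq0 hQ oI hdelta _ _ Its dt
  (is_derive_f dz) (is_derive_g dz)) _.
by rewrite /ruling [in RHS]scalerDr !scalerA.
Qed.

Lemma d_t_surface u v : I u ->
  d_t ruled_surface u v = surface_speed u v *: T u.
Proof.
move=> Iu; have dv : is_derive u 1 (cst v : R -> R) 0 by exact: is_derive_cst.
have := derive1_is_derive
  (is_derive_surface (t := id) (z := cst v) Iu (is_derive_id u 1) dv).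
by rewrite mul1r scale0r addr0.
Qed.

Lemma d_z_surface u v : I u -> d_z ruled_surface u v = ruling u v.
Proof.
move=> Iu; have du : is_derive v 1 (cst u : R -> R) 0 by exact: is_derive_cst.
have := derive1_is_derive
  (is_derive_surface (t := cst u) (z := id) Iu du (is_derive_id v 1)).
by rewrite mul0r scale0r add0r scale1r.
Qed.

(** The rulings are geodesics of M^3(C), so X_zz = - C X, which gives the [z'] term; the [t'] term
    is the rotation of X_z against [T]. *)
Lemma is_derive_ruling (t z : R -> R) t' z' (s : R) : I (t s) ->
  is_derive s 1 t t' -> is_derive s 1 z z' ->
  is_derive s 1 (fun x => ruling (t x) (z x))
    ((- t' * angle_rate (t s) (z s)) *: T (t s)
     - (C * z') *: ruled_surface (t s) (z s)).
Proof.
move=> Its dt dz.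
have dg : is_derive s 1 (fun x => - C * r * g (z x)) (- C * (z' * f (z s))).
  rewrite [X in is_derive _ _ X _](_ : _ = - C *: (fun x => r * g (z x))).
    exact: is_deriveZ (is_derive_g dz).
  by apply/funext => x; rewrite -mulrA.
apply: is_derive_eq (is_derive_ruled curvature_neq0 hQ oI hdelta _ _ Its dt
  dg (is_derive_f dz)) _.
by apply/rowP => i; rewrite /ruled_surface /angle_rate !mxE; ring.
Qed.

(** The case u = 0, v = 1 of [is_derive_ruled]: N is constant along rulings and varies only in the
    direction of [T]. *)
Lemma is_derive_normal (t z : R -> R) t' (s : R) : I (t s) ->
  is_derive s 1 t t' ->
  is_derive s 1 (fun x => surface_normal (t x) (z x))
    ((t' * (sin a * kd (t s) - cos a * k)) *: T (t s)).
Proof.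
move=> Its dt.
have c1 : is_derive s 1 (cst 1 : R -> R) 0 by exact: is_derive_cst.
have c0 : is_derive s 1 (cst 0 : R -> R) 0 by exact: is_derive_cst.
have := is_derive_ruled curvature_neq0 hQ oI hdelta (- sin a) (cos a) Its dt c0 c1.
rewrite [X in is_derive _ _ X _ -> _](_ : _ =
    (fun x => surface_normal (t x) (z x))); last first.
  by apply/funext => x; rewrite /= scale0r scale1r add0r.
move/is_derive_eq; apply; rewrite !scale0r !addr0; congr (_ *: _).
by rewrite /=; ring.
Qed.

Lemma derivable_angle_rate (t z : R -> R) (s : R) : I (t s) ->
  derivable t s 1 -> derivable z s 1 ->
  derivable (fun x => angle_rate (t x) (z x)) s 1.
Proof.
move=> Its /derivableP dt /derivableP dz.
have dk := is_derive_reparam (derivableP (derivable_kd hQ oI hdelta Its)) dt.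
rewrite (_ : (fun x => _) = C *: (fun x => r * g (z x)) + (fun x => f (z x)) *
    (cst (sin a * k) + cos a *: (fun x => kd (t x)))); last first.
  by apply/funext => x; rewrite /angle_rate -mulrA.
apply: derivableD; first by apply: derivableZ; have [] := is_derive_g dz.
apply: derivableM; first by have [] := is_derive_f dz.
by apply: derivableD; [exact: derivable_cst|apply: derivableZ; case: dk].
Qed.

(** * Curves on the surface: acceleration, geodesics and the direction of the binormal *)

Section curve.
Variables (L : set R) (oiL : open_interval L) (t z : R -> R).
Hypotheses (t_smooth : smooth_on L t) (z_smooth : smooth_on L z).
Hypothesis Lt : forall s, L s -> I (t s).
Let gamma s := ruled_surface (t s) (z s).
Let normal s := surface_normal (t s) (z s).
Let Z s := ruling (t s) (z s).
Hypothesis arclength :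
  forall s, L s -> ip nu (derive1 gamma s) (derive1 gamma s) = 1.

Local Notation t' := (derive1 t).
Local Notation z' := (derive1 z).
Let P s := t' s * surface_speed (t s) (z s).
(** The rotation speed of the tangent frame: the derivative of [T (t s)] has scalar product
    [omega s] with [Z s]. *)
Let omega s := t' s * angle_rate (t s) (z s).

Let dt s : L s -> is_derive s 1 t (t' s).
Proof. exact: smooth_is_derive1. Qed.

Let dz s : L s -> is_derive s 1 z (z' s).
Proof. exact: smooth_is_derive1. Qed.

Let gammaE s : L s -> derive1 gamma s = P s *: T (t s) + z' s *: Z s.
Proof.
move=> Ls; apply: derive1_is_derive.
exact: is_derive_surface (Lt Ls) (dt Ls) (dz Ls).
Qed.

Let velocity_ip s : L s ->
  [/\ ip nu (derive1 gamma s) (T (t s)) = P s,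
      ip nu (derive1 gamma s) (Z s) = z' s &
      ip nu (derive1 gamma s) (normal s) = 0].
Proof.
move=> Ls; rewrite gammaE//.
have [_ [_ [[TZ TN ZN] [TT ZZ _]]]] := surface_frame_gram (z s) (Lt Ls).
by split; rewrite ipDl !ipZl ?(ipC _ (Z s) (T _)) ?TT ?TZ ?TN ?ZN ?ZZ; ring.
Qed.

Lemma unit_speed s : L s -> P s ^+ 2 + z' s ^+ 2 = 1.
Proof.
move=> Ls; have [VT VZ _] := velocity_ip Ls.
by rewrite -(arclength Ls) {2}gammaE// ipDr !ipZr VT VZ.
Qed.

Hypothesis gamma_smooth : forall s, L s -> derivable (derive1 gamma) s 1.
Local Notation acc := (derive1 (derive1 gamma)).

Let dV s : L s -> is_derive s 1 (derive1 gamma) (acc s).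
Proof. by move=> Ls; apply: derivable_is_derive1; apply: gamma_smooth. Qed.

Let dT s : L s -> is_derive s 1 (fun x => T (t x)) (t' s *:
  (- C *: delta (t s) + k *: eta (delta (t s)) + kd (t s) *: Nd (t s))).
Proof.
move=> Ls.
exact: is_derive_reparam (is_derive_T hQ oI hdelta (Lt Ls)) (dt Ls).
Qed.

Let T'_ruling s : L s -> ip nu
    (- C *: delta (t s) + k *: eta (delta (t s)) + kd (t s) *: Nd (t s)) (Z s) =
  angle_rate (t s) (z s).
Proof.
move=> Ls.
have [[_ dN de] [[_ _ Ne] [_ NN ee]]] := moving_frame_gram hQ oI hdelta (Lt Ls).
rewrite /Z /ruling /angle_rate !ipbi !(ipC _ (Nd (t s)) (delta (t s)))
  !(ipC _ (eta _) (delta (t s))) !(ipC _ (eta _) (Nd (t s))).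
rewrite (M3_delta hdelta (Lt Ls)) dN de Ne NN ee.
set x := f _; set y := g _.
transitivity (C * C^-1 * (C * r * y) + x * (sin a * k + cos a * kd (t s))).
  by ring.
by rewrite divff ?curvature_neq0// mul1r.
Qed.

Let T'_T s : L s -> ip nu
    (- C *: delta (t s) + k *: eta (delta (t s)) + kd (t s) *: Nd (t s))
    (T (t s)) = 0.
Proof.
move=> Ls.
have [[dT0 _ _] [[TN Te _] _]] := moving_frame_gram hQ oI hdelta (Lt Ls).
by rewrite !ipbi dT0 (ipC _ (Nd _)) TN (ipC _ (eta _)) Te; ring.
Qed.

(** Differentiate <gamma', T> = P. As T' is orthogonal to T, only the X_z component of gamma'
    contributes to <gamma', T'>. *)
Lemma is_derive_P s : L s ->
  is_derive s 1 P (ip nu (acc s) (T (t s)) + omega s * z' s).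
Proof.
move=> Ls; have VT x : L x -> ip nu (derive1 gamma x) (T (t x)) = P x.
  by move=> /velocity_ip[].
apply: (open_eq_is_derive oiL.1 Ls VT).
apply: is_derive_eq (is_derive_ip nu (dV Ls) (dT Ls)) _; congr (_ + _).
rewrite gammaE// !ipZr ipDl !ipZl (ipC _ (T _)) T'_T// (ipC _ (Z s)) T'_ruling//.
by rewrite /omega; ring.
Qed.

(** Differentiate <gamma', X_z> = z'. The multiple of X in the derivative of X_z is orthogonal to
    gamma'. *)
Lemma is_derive_z' s : L s ->
  is_derive s 1 z' (ip nu (acc s) (Z s) - omega s * P s).
Proof.
move=> Ls; have VZ x : L x -> ip nu (derive1 gamma x) (Z x) = z' x.
  by move=> /velocity_ip[].
apply: (open_eq_is_derive oiL.1 Ls VZ).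
have dZ := is_derive_ruling (Lt Ls) (dt Ls) (dz Ls).
apply: is_derive_eq (is_derive_ip nu (dV Ls) dZ) _; congr (_ + _).
have [VT _ _] := velocity_ip Ls.
have [_ [[pT pZ _] _]] := surface_frame_gram (z s) (Lt Ls).
rewrite ipDr ipNr !ipZr VT gammaE// ipDl !ipZl.
by rewrite (ipC _ (T _)) (ipC _ (Z s)) pT pZ /omega; ring.
Qed.

(** Differentiating <gamma', N> = 0 trades the acceleration for the derivative of N, which is
    parallel to T. *)
Lemma acceleration_normal s : L s ->
  ip nu (acc s) (normal s) = P s * (t' s * (k * cos a - sin a * kd (t s))).
Proof.
move=> Ls; have VN x : L x -> ip nu (derive1 gamma x) (normal x) = 0.
  by move=> /velocity_ip[].
have dN := is_derive_normal z (Lt Ls) (dt Ls).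
have /eqP := ip_cst_derive oiL.1 Ls VN (dV Ls) dN.
have [VT _ _] := velocity_ip Ls.
by rewrite ipZr VT addr_eq0 => /eqP ->; ring.
Qed.

(** In the frame (X, T, X_z, N), the two projections remove exactly the X and N components of the
    acceleration. *)
Lemma surf_covD_velocity s : L s ->
  surf_covD nu C gamma normal (derive1 gamma) s =
  ip nu (acc s) (T (t s)) *: T (t s) + ip nu (acc s) (Z s) *: Z s.
Proof.
move=> Ls.
have [pp [[pT pZ pN] [[TZ TN ZN] [TT ZZ NN]]]] := surface_frame_gram (z s) (Lt Ls).
rewrite /surf_covD /covD /proj_M3.
rewrite (ipDl _ (acc s)) ipNl ipZl (_ : ip nu (gamma s) (normal s) = 0)//.
rewrite mulr0 subr0.
have := frame_expansion pp pT pZ pN TT TZ TN ZZ ZN NN (acc s).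
rewrite -/(gamma s) -/(normal s) -/(Z s) => {1}->.
by apply/rowP => i; rewrite !mxE; ring.
Qed.

Lemma geodesic_components :
  geodesic nu C L gamma normal <->
  forall s, L s -> ip nu (acc s) (T (t s)) = 0 /\ ip nu (acc s) (Z s) = 0.
Proof.
split=> H s Ls; last first.
  by rewrite surf_covD_velocity//; have [-> ->] := H s Ls; rewrite !scale0r addr0.
have [_ [_ [[TZ _ _] [TT ZZ _]]]] := surface_frame_gram (z s) (Lt Ls).
have := H s Ls; rewrite surf_covD_velocity// => H0.
split.
  have := congr1 (fun v => ip nu v (T (t s))) H0.
  by rewrite ip0l ipDl !ipZl TT /Z (ipC _ (ruling _ _) (T _)) TZ mulr1 mulr0 addr0.
have := congr1 (fun v => ip nu v (Z s)) H0.
by rewrite ip0l ipDl !ipZl /Z TZ ZZ mulr0 add0r mulr1.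
Qed.

(** Without tangential acceleration, the equations for P' and z'' are the rotation system of
    [angle_lift]. Conversely, differentiating P = sin theta and z' = cos theta and comparing with
    those equations forces both tangential components to vanish. *)
Lemma geodesic_angle :
  geodesic nu C L gamma normal <->
  exists theta : R -> R, forall s, L s ->
    [/\ is_derive s 1 theta (omega s), P s = sin (theta s) & z' s = cos (theta s)].
Proof.
rewrite geodesic_components; split=> [H|[theta Htheta] s Ls].
  apply: (angle_lift oiL) => s; rewrite ?inE => Ls.
  (* Continuity of [omega], obtained from its derivability. *)
  - apply/differentiable_continuous/derivable1_diffP; apply: derivableM.
      by have [] := smooth_is_derive1 (smooth_derive1 t_smooth) Ls.
    by apply: derivable_angle_rate; [exact: Lt|have [] := dt Ls|have [] := dz Ls].
  - exact: unit_speed.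
  - by apply: is_derive_eq (is_derive_P Ls) _; have [-> _] := H s Ls; rewrite add0r.
  - apply: is_derive_eq (is_derive_z' Ls) _; have [_ ->] := H s Ls.
    by rewrite sub0r mulNr.
have [dtheta Ps zs] := Htheta s Ls.
split.
  have dsin : is_derive s 1 (sin \o theta) (cos (theta s) * omega s).
    exact: is_derive1_comp.
  have sinP x : L x -> (sin \o theta) x = P x by move=> /Htheta[_ ->].
  have [_ ] := open_eq_is_derive oiL.1 Ls sinP dsin.
  have [_ ->] := is_derive_P Ls.
  by rewrite zs mulrC => /eqP; rewrite -subr_eq0 addrK => /eqP.
have dcos : is_derive s 1 (cos \o theta) (- sin (theta s) * omega s).
  exact: is_derive1_comp.
have cosz x : L x -> (cos \o theta) x = z' x by move=> /Htheta[_ _ ->].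
have [_ ] := open_eq_is_derive oiL.1 Ls cosz dcos.
have [_ ->] := is_derive_z' Ls.
by rewrite Ps mulNr mulrC => /eqP; rewrite -subr_eq0 opprK subrK => /eqP.
Qed.

(* v is a unit vector orthogonal to gamma, gamma' and N, hence +/- (z' T - P Z);
   the sign is that of [z' <v,T> - P <v,Z>], the determinant of the frame change. *)
Lemma torsion_direction (o : bool) s (v : 'rV[R]_4) : L s ->
  positive_frame o (gamma s) (T (t s)) (Z s) (normal s) ->
  positive_frame o (gamma s) (derive1 gamma s) (normal s) v ->
  ip nu v v = 1 -> ip nu v (gamma s) = 0 -> ip nu v (normal s) = 0 ->
  ip nu v (derive1 gamma s) = 0 -> ip nu v (T (t s)) = z' s.
Proof.
move=> Ls pos1 pos2 vv vp vN; rewrite gammaE// ipDr !ipZr => vV.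
have PQ := unit_speed Ls.
have [pp [[pT pZ pN] [[TZ TN ZN] [TT ZZ NN]]]] := surface_frame_gram (z s) (Lt Ls).
have := frame_expansion pp pT pZ pN TT TZ TN ZZ ZN NN v.
rewrite -/(gamma s) -/(normal s) -/(Z s) vp vN mulr0 !scale0r add0r addr0.
set b1 := ip nu v (T _) in vV *; set b2 := ip nu v (Z s) in vV * => vE.
have b12 : b1 ^+ 2 + b2 ^+ 2 = 1.
  transitivity (ip nu v (b1 *: T (t s) + b2 *: Z s)); last by rewrite -vE.
  by rewrite ipDr !ipZr !expr2.
(* The ratio of the determinants of the two positive frames. *)
have det0 : 0 < z' s * b1 - P s * b2.
  move: pos1 pos2; rewrite /positive_frame gammaE// vE det_frame_rotation.
  by rewrite mulrCA => p1; rewrite pmulr_lgt0.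
set p := P s in vV PQ det0; set q := z' s in vV PQ det0 *.
(* Lagrange's identity, where p b1 + q b2 = 0 by orthogonality to gamma'; positivity in [det0] then
   selects the root 1. *)
have bE : (q * b1 - p * b2) ^+ 2 = 1.
  transitivity ((p ^+ 2 + q ^+ 2) * (b1 ^+ 2 + b2 ^+ 2) - (p * b1 + q * b2) ^+ 2).
    by ring.
  by rewrite PQ b12 vV; ring.
have {}bE : q * b1 - p * b2 = 1.
  by apply/eqP; rewrite -(eqrXn2 (n := 2))// ?ltW// bE expr1n.
transitivity ((p ^+ 2 + q ^+ 2) * b1); first by rewrite PQ mul1r.
transitivity (q * (q * b1 - p * b2) + p * (p * b1 + q * b2)); first by ring.
by rewrite bE vV; ring.
Qed.

End curve.
End surface.

(** * The geodesic criterion, then curvature and torsion from the Frenet equations *)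

Theorem proposition11 (R : realType)
  (nu : bool) (C r : R) (r_gt0 : 0 < r) (defC : C = (-1) ^+ nu / r ^+ 2)
  (w : 'rV[R]_4) (d : R) (w_neq0 : w != 0)
  (eta : 'rV[R]_4 -> 'rV[R]_4) (k : R) (hQ : Q2_normal nu C w d eta k)
  (I : set R) (hI : open_interval I)
  (delta Nd : R -> 'rV[R]_4) (kd : R -> R)
  (hdelta : Q2_curve nu C w d eta I delta Nd kd)
  (a : R) (J : set R) (hJ : open_interval J) (J0 : J 0)
  (X : R -> R -> 'rV[R]_4)
  (defX : X = fun t z => fC C (z / r) *: delta t +
     (r * gC C (z / r)) *: (cos a *: Nd t + sin a *: eta (delta t)))
  (N : R -> R -> 'rV[R]_4)
  (defN : N = fun t z => - sin a *: Nd t + cos a *: eta (delta t))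
  (E : R -> R -> R)
  (defE : E = fun t z => ip nu (d_t X t z) (d_t X t z))
  (hE : forall t z, I t -> J z ->
     0 < E t z /\ d_t X t z = Num.sqrt (E t z) *: derive1 delta t)
  (hM : concircular_surface nu C I J X N)
  (nontrivial : ~ totally_umbilical nu C I J X N)
  (o : bool)
  (ho : forall t z, I t -> J z ->
     positive_frame o (X t z) (derive1 delta t) (d_z X t z) (N t z))
  (L : set R) (hL : open_interval L) (t z : R -> R)
  (t_smooth : smooth_on L t) (z_smooth : smooth_on L z)
  (htz : forall s, L s -> I (t s) /\ J (z s))
  (gamma : R -> 'rV[R]_4) (defgamma : gamma = fun s => X (t s) (z s))
  (arclength : forall s, L s -> ip nu (derive1 gamma s) (derive1 gamma s) = 1)
  (kappa tau : R -> R) (Tg Ng Bg : R -> 'rV[R]_4)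
  (hfrenet : frenet nu C o L gamma kappa tau Tg Ng Bg)
  (kappa_gt0 : forall s, L s -> 0 < kappa s) :
  let Ngamma := fun s => N (t s) (z s) in
  (geodesic nu C L gamma Ngamma <->
     exists theta : R -> R, angle_system C r a k kd E L t z theta) /\
  (forall theta : R -> R, angle_system C r a k kd E L t z theta ->
     (forall s, L s -> Ng s = Ngamma s) ->
     forall s, L s ->
       kappa s = sin (theta s) * derive1 t s * (k * cos a - sin a * kd (t s)) /\
       tau s = cos (theta s) * derive1 t s * (- cos a * k + sin a * kd (t s))).
Proof.
have [oI _] := hI.
have Lt s : L s -> I (t s) by move=> /htz[].
have XE : X = ruled_surface C r eta delta Nd a := defX.
have NE : N = surface_normal eta delta Nd a := defN.
have gE : gamma = fun s => ruled_surface C r eta delta Nd a (t s) (z s).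
  by rewrite defgamma XE.
have d_zE u v : I u -> d_z X u v = ruling C r eta delta Nd a u v.
  by move=> Iu; rewrite XE (d_z_surface r_gt0 defC hQ oI hdelta).
(* Pairing both expressions of X_t with the unit vector T identifies the square root of E with
   [surface_speed]. *)
have speedE u v : I u -> J v -> Num.sqrt (E u v) = surface_speed C r k kd a u v.
  move=> Iu Jv; have [_] := hE _ _ Iu Jv.
  rewrite XE (d_t_surface r_gt0 defC hQ oI hdelta)//.
  have [_ _ qd _ _] := hdelta; have [_ TT] := qd _ Iu.
  by move=> /(congr1 (fun x => ip nu x (derive1 delta u))); rewrite !ipZl TT !mulr1.
have [[sT sN sB] tang gram pos frenet_eq] := hfrenet.
have TgE s : L s -> Tg s = derive1 gamma s by move=> /tang[].
(* The second derivative of gamma exists because the Frenet tangent is smooth and equals gamma' on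
   the open set [L]. *)
have dTg s : L s -> is_derive s 1 (derive1 gamma) (derive1 Tg s).
  move=> Ls; apply: (open_eq_is_derive hL.1 Ls TgE).
  exact: smooth_is_derive1 sT Ls.
have dV s : L s -> derivable (derive1 gamma) s 1 by move=> /dTg[].
have angleE theta : angle_system C r a k kd E L t z theta <->
    forall s, L s ->
    [/\ is_derive s 1 theta (derive1 t s * angle_rate C r k kd a (t s) (z s)),
        derive1 t s * surface_speed C r k kd a (t s) (z s) = sin (theta s) &
        derive1 z s = cos (theta s)].
  split=> H s Ls; have [Is Js] := htz _ Ls.
    have [dth Hs Hc Hd] := H s Ls; rewrite -speedE//; split=> //.
    by rewrite -Hd; exact: derivable_is_derive1.
  have [dth Hs Hc] := H s Ls; rewrite speedE//; split=> //.
  exact: derive1_is_derive dth.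
move: arclength dV; rewrite gE => arclength dV Ngamma.
have NgE : Ngamma = fun s => surface_normal eta delta Nd a (t s) (z s).
  by rewrite /Ngamma NE.
split.
  rewrite NgE (geodesic_angle r_gt0 defC hQ oI hdelta hL t_smooth z_smooth Lt
    arclength dV).
  by split=> -[theta Htheta]; exists theta; apply/angleE.
move=> theta /angleE Htheta NgN s Ls.
have [_ Ps zs] := Htheta s Ls; have [Is Js] := htz _ Ls.
have [_ tTg tN tB] := tang s Ls.
have [[TT NN BB] [TN TB NB]] := gram s Ls.
have [cT cN _] := frenet_eq s Ls.
have acc : derive1 Tg s = derive1 (derive1 gamma) s.
  by have [_ <-] := dTg s Ls; rewrite derive1E.
have dNg : derive1 Ng s =
    (derive1 t s * (sin a * kd (t s) - cos a * k)) *: derive1 delta (t s).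
  have NgNV x : L x -> Ngamma x = Ng x by move=> /NgN.
  apply: derive1_is_derive; apply: (open_eq_is_derive hL.1 Ls NgNV).
  rewrite NgE; have dt := smooth_is_derive1 t_smooth Ls.
  exact: (is_derive_normal r_gt0 defC hQ oI hdelta a z Is dt).
(* Pair the first Frenet equation with N_gamma; the projection in [covD] subtracts a multiple of
   gamma, which is orthogonal to N_gamma. The torsion is treated likewise with B_gamma. *)
have kappaE : kappa s = ip nu (derive1 (derive1 gamma) s) (Ng s).
  have := congr1 (fun v => ip nu v (Ng s)) cT.
  rewrite /covD /proj_M3 acc ipDl ipNl !ipZl NN mulr1 => <-.
  by rewrite (ipC _ (gamma s)) tN mulr0 subr0.
have tauE : tau s = ip nu (derive1 Ng s) (Bg s).
  have := congr1 (fun v => ip nu v (Bg s)) cN.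
  rewrite /covD /proj_M3 !ipDl ipNl !ipZl TB BB mulr0 add0r mulr1 => <-.
  by rewrite (ipC _ (gamma s)) tB mulr0 subr0.
split.
  rewrite kappaE NgN// NgE gE.
  rewrite (acceleration_normal r_gt0 defC hQ oI hdelta hL t_smooth z_smooth Lt dV Ls).
  by rewrite Ps; ring.
rewrite tauE dNg ipZl ipC.
(* As N' is parallel to T, the torsion involves only the T component of B_gamma, and the orientation
   fixes it as z' = cos theta. *)
have -> : ip nu (Bg s) (derive1 delta (t s)) = derive1 z s.
  apply: (torsion_direction r_gt0 defC hQ oI hdelta t_smooth z_smooth Lt arclength
    (o := o) Ls) => //.
  - have := ho _ _ Is Js; rewrite d_zE// XE NE; exact.
  - have := pos s Ls; rewrite TgE// NgN// NgE gE; exact.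
  - by move: tB; rewrite /tangent_M3 gE.
  - by move: NB; rewrite (ipC _ (Bg s)) NgN// NgE.
  - by rewrite -gE -TgE// ipC.
by rewrite zs; ring.
Qed.
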